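(* Let $\mathbb{K}\in\{\mathbb{R},\mathbb{C}\}$, let $\Omega$ be a set and $\varphi_1,\ldots,\varphi_n:\Omega\to\mathbb{K}$ functions. Let $N=\dim_{\mathbb{K}}\operatorname{lin}_{\mathbb{K}}\{\varphi_k\overline{\varphi_l}: k,l=1,\ldots,n\}$. The following assertions are equivalent. (i) $\bm{I}_n\in\operatorname{cone}\big\{(\varphi_k(x)\overline{\varphi_l(x)})_{k,l=1}^n: x\in\Omega\big\}$. (ii) There exists a positive measure $\mu$ and an associated $\sigma$-algebra $\Sigma$ of measurable sets in $\Omega$ such that the system $\{\varphi_j\}_{j=1}^n$ is orthonormal with respect to $\mu$, i.e. $$\int_\Omega\varphi_k(x)\overline{\varphi_l(x)}\,\mathrm{d}\mu(x)=\delta_{k,l},\quad k,l=1,\ldots,n.$$ (iii) There exist $N$ points $x_1,\ldots,x_N\in\Omega$ and non-negative weights $\mu_1,\ldots,\mu_N$ such that $\{\varphi_j\}_{j=1}^n$ is orthonormal with respect to the discrete measure $\sum_{j=1}^N\mu_j\delta_{x_j}$, i.e. $$\sum_{j=1}^N\mu_j\varphi_k(x_j)\overline{\varphi_l(x_j)}=\delta_{k,l},\quad k,l=1,\ldots,n.$$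
   Context: $\bm{I}_n$ is the $n\times n$ identity matrix. $\operatorname{lin}_{\mathbb{K}}$ is the $\mathbb{K}$-linear span. For a subset $M$ of a real or complex vector space, $\operatorname{cone}M:=\{\sum_{j=1}^m\lambda_jv_j: v_j\in M,\ \lambda_j\ge0,\ m\in\mathbb{N}\}$. In (ii), orthonormality includes that the $\varphi_j$ are measurable with respect to $\Sigma$ and square-integrable with respect to $\mu$; a positive measure takes values in $[0,\infty]$. *)

(* Defs.v *)
From HB Require Import structures.
From mathcomp Require Import all_boot all_order all_algebra.
From mathcomp Require Import complex.
From mathcomp Require Import all_classical all_reals all_analysis.

Import Order.TTheory GRing.Theory Num.Theory.
Import numFieldNormedType.Exports.

#[export] Set Implicit Arguments.
#[export] Unset Strict Implicit.
#[export] Unset Printing Implicit Defensive.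

Local Open Scope classical_set_scope.
Local Open Scope ring_scope.
Local Open Scope complex_scope.

Variant scalars := RealScalars | ComplexScalars.

Definition scalar_field (R : realType) (s : scalars) : numFieldType :=
  match s with RealScalars => R | ComplexScalars => R[i] end.

Definition of_real (R : realType) (s : scalars) : R -> scalar_field R s :=
  match s return R -> scalar_field R s with
  | RealScalars => fun a => a
  | ComplexScalars => fun a => a%:C
  end.

Definition conjK (R : realType) (s : scalars) :
    scalar_field R s -> scalar_field R s :=
  match s return scalar_field R s -> scalar_field R s with
  | RealScalars => fun a => a
  | ComplexScalars => fun z => conjc z
  end.

Definition absK (R : realType) (s : scalars) : scalar_field R s -> R :=
  match s return scalar_field R s -> R with
  | RealScalars => fun a => `|a|
  | ComplexScalars => fun z => complex.Re `|z|
  end.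

Section linear_span.
Variables (F : fieldType) (V : lmodType F).

Definition lin (M : set V) : set V :=
  [set v | exists (m : nat) (c : 'I_m -> F) (u : 'I_m -> V),
     (forall j, M (u j)) /\ v = \sum_(j < m) c j *: u j].

Definition linearly_independent (N : nat) (b : 'I_N -> V) : Prop :=
  forall c : 'I_N -> F, \sum_(j < N) c j *: b j = 0 -> forall j, c j = 0.

(* W is meant to be a linear subspace of V, where V (such as a space of all
   functions on a set) need not be finite-dimensional. *)
Definition has_dim (W : set V) (N : nat) : Prop :=
  exists b : 'I_N -> V, linearly_independent b /\ lin (range b) = W.

End linear_span.

Definition cone (R : realType) (s : scalars) (V : lmodType (scalar_field R s))
    (M : set V) : set V :=
  [set v | exists (m : nat) (lambda : 'I_m -> R) (u : 'I_m -> V),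
     [/\ forall j, 0 <= lambda j, forall j, M (u j) &
         v = \sum_(j < m) of_real s (lambda j) *: u j]].

Section integration.
Variables (R : realType) (s : scalars).
Variables (d : measure_display) (T : measurableType d).
Variable mu : {measure set T -> \bar R}.

Definition measurableK : (T -> scalar_field R s) -> Prop :=
  match s return (T -> scalar_field R s) -> Prop with
  | RealScalars => fun f => measurable_fun setT (f : T -> R)
  | ComplexScalars => fun f =>
      measurable_fun setT (fun x => complex.Re (f x)) /\
      measurable_fun setT (fun x => complex.Im (f x))
  end.

Definition square_integrable (f : T -> scalar_field R s) : Prop :=
  (\int[mu]_x ((absK (f x) ^+ 2)%:E) < +oo)%E.

(* [Rintegral] is a total operator returning a default value on functions that
   are not integrable; it is only applied below to products f * conj g of
   measurable square-integrable functions, which are integrable. *)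
Definition integralK : (T -> scalar_field R s) -> scalar_field R s :=
  match s return (T -> scalar_field R s) -> scalar_field R s with
  | RealScalars => fun f => Rintegral mu setT f
  | ComplexScalars => fun f =>
      Rintegral mu setT (fun x => complex.Re (f x)) +i*
      Rintegral mu setT (fun x => complex.Im (f x))
  end.

Definition orthonormal_system (n : nat) (phi : 'I_n -> T -> scalar_field R s) :
    Prop :=
  [/\ forall j, measurableK (phi j),
      forall j, square_integrable (phi j) &
      forall k l,
        integralK (fun x => phi k x * conjK (phi l x)) = (k == l)%:R].

End integration.

(* scalar_field R s is turned by ^o into a module over itself, which makes
   functions from Omega into it a vector space. *)
Definition pairwise_products (R : realType) (s : scalars) (Omega : Type)
    (n : nat) (phi : 'I_n -> Omega -> scalar_field R s) :
    set (Omega -> (scalar_field R s)^o) :=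
  [set f | exists k l : 'I_n, f = fun x => phi k x * conjK (phi l x)].

(* A measurableType is pointed, so a base point has to be supplied before a
   sigma-algebra on an arbitrary type can be made into one. *)
Definition pointed_at (Omega : Type) (x0 : Omega) : Type := Omega.

HB.instance Definition _ (Omega : Type) (x0 : Omega) :=
  Choice.copy (pointed_at x0) {classic Omega}.
HB.instance Definition _ (Omega : Type) (x0 : Omega) :=
  isPointed.Build (pointed_at x0) x0.

(* Asking for a base point loses nothing when 0 < n: on an empty Omega all
   integrals vanish and no such system is orthonormal.  The sigma-algebra
   generated by a sigma-algebra Sigma is Sigma itself (sigma_algebra_id), so
   mu below is a measure on Sigma. *)
Definition orthonormal_for_some_measure (R : realType) (s : scalars)
    (Omega : Type) (n : nat) (phi : 'I_n -> Omega -> scalar_field R s) : Prop :=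
  exists (x0 : Omega) (Sigma : set (set (pointed_at x0)))
         (mu : {measure set (g_sigma_algebraType Sigma) -> \bar R}),
    sigma_algebra setT Sigma /\ orthonormal_system mu phi.

(* Main.v *)
Require Import Defs.
From mathcomp Require Import all_boot all_order all_algebra.
From mathcomp Require Import complex ring lra.
From mathcomp Require Import all_classical all_reals all_analysis.
From mathcomp Require Import measurable_realfun.

Import Order.TTheory GRing.Theory Num.Theory.

Local Open Scope classical_set_scope.
Local Open Scope ring_scope.

(** Write [A x] for the matrix of the products [phi_k x * conj (phi_l x)].
    Orthonormality with respect to [mu] says that the integral of [A] is the
    identity matrix, so the theorem asks when the identity is a nonnegative
    combination of the matrices [A x], taken with respect to some measure, over
    finitely many points, or over at most [N] points.  A finite conic combination is the
    integral against a discrete measure, which settles every implication that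
    starts from points ([discrete_measure]).  Two arguments remain.

    An integral of a vector-valued function lies in the convex cone spanned by
    its values ([integral_in_conic_hull], a theorem of Richter).  The cone need
    not be closed, so approximating the integral is not enough.  Instead, if
    the integral [L] were outside the cone, some nonzero linear functional [l]
    would be nonnegative on the cone and nonpositive at [L]
    ([supporting_functional]).  Then [l (A x)] is nonnegative with a
    nonpositive integral, hence it vanishes almost everywhere; off a null set
    the function takes its values in the hyperplane [l = 0], and induction on
    the dimension applies.

    Conic combinations can be reduced until the matrices used are linearly
    independent over the reals ([conic_caratheodory]).  As these matrices are
    Hermitian, they are then independent over the scalars too: the real and
    imaginary parts of a scalar relation are combinations of this relation and
    its conjugate transpose, so they are relations themselves
    ([real_independent_scalar_independent]).  Finally, points [x_1 .. x_m] with
    independent matrices give [m] independent evaluation functionals on the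
    [N]-dimensional span of the products, whence [m <= N]
    ([leq_dim_of_independent_points]); points with weight zero make up for the
    difference.

    Real and complex scalars are treated together through the real coordinates
    [coordK] of a scalar; matrices become real row vectors by [realify]. *)

(** * Convex cones in finite dimension *)

(** The generators are indexed by the points of [D] so that the hull of a
    function restricted to a smaller set is again of this form. *)
Definition conic_hull (R : numDomainType) (V : lmodType R) (T : Type)
    (D : set T) (a : T -> V) : set V :=
  [set v | exists (m : nat) (lambda : 'I_m -> R) (x : 'I_m -> T),
     [/\ forall j, 0 <= lambda j, forall j, D (x j) &
         v = \sum_(j < m) lambda j *: a (x j)]].

Definition convex_cone (R : numDomainType) (V : lmodType R) (K : set V) :
    Prop :=
  [/\ K 0, forall u v, K u -> K v -> K (u + v) &
      forall t u, 0 <= t -> K u -> K (t *: u)].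

Lemma conic_hull_convex_cone (R : numDomainType) (V : lmodType R) (T : Type)
    (D : set T) (a : T -> V) : convex_cone (conic_hull D a).
Proof.
split.
- have x0 : 'I_0 -> T by case.
  by exists 0, (fun=> 0), x0; split=> [[]|[]|]; rewrite ?big_ord0.
- move=> _ _ [m1 [c1 [x1 [c1_ge0 Dx1 ->]]]] [m2 [c2 [x2 [c2_ge0 Dx2 ->]]]].
  exists (m1 + m2)%N,
    (fun j => match fintype.split j with inl i => c1 i | inr i => c2 i end),
    (fun j => match fintype.split j with inl i => x1 i | inr i => x2 i end).
  split=> [j|j|]; try by case: (fintype.split j).
  rewrite big_split_ord; congr (_ + _); apply: eq_bigr => i _.
    by rewrite (unsplitK (inl i)).
  by rewrite (unsplitK (inr i)).
- move=> t _ t_ge0 [m [c [x [c_ge0 Dx ->]]]].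
  exists m, (fun j => t * c j), x; split=> // [j|]; first exact: mulr_ge0.
  by rewrite scaler_sumr; apply: eq_bigr => j _; rewrite scalerA.
Qed.

Lemma mem_conic_hull (R : numDomainType) (V : lmodType R) (T : Type)
    (D : set T) (a : T -> V) (x : T) : D x -> conic_hull D a (a x).
Proof.
by exists 1, (fun=> 1), (fun=> x); split=> //; rewrite big_ord1 scale1r.
Qed.

(** No closedness is assumed, so a functional cannot be obtained from a nearest
    point; it is built one coordinate [t] at a time.  If the cone avoids one of
    the open half-spaces [t > 0] and [t < 0], then [t] or its opposite does.
    Otherwise the slice [t = 0] is itself a proper cone, since a full slice
    together with one point on each side would generate everything; a
    functional of the slice then extends, because the lower bounds imposed on
    the new coefficient by the points with [t = 1] do not exceed the upper
    bounds imposed by the points with [t = -1]. *)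
Lemma supporting_functional (R : realType) (d : nat) (K : set 'rV[R]_d) :
    convex_cone K -> K <> setT ->
  exists2 l : 'cV[R]_d, l != 0 & forall u, K u -> 0 <= (u *m l) 0 0.
Proof.
elim: d K => [|d IHd] K [K0 KD KZ] properK.
  case: properK; apply/seteqP; split=> // u _.
  by rewrite (_ : u = 0) //; apply/rowP; case.
pose pt (t : R) (u : 'rV[R]_d) : 'rV[R]_(1 + d) := row_mx t%:M u.
have ptP (w : 'rV[R]_(1 + d)) : exists t u, w = pt t u.
  by exists (lsubmx w 0 0), (rsubmx w); rewrite /pt -mx11_scalar hsubmxK.
have pt_mul c t u (l : 'cV[R]_d) :
    (pt t u *m col_mx c%:M l) 0 0 = t * c + (u *m l) 0 0.
  by rewrite mul_row_col mxE -scalar_mxM mxE eqxx mulr1n.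
have ptD t u t' u' : pt t u + pt t' u' = pt (t + t') (u + u').
  by rewrite /pt add_row_mx raddfD.
have ptZ c t u : c *: pt t u = pt (c * t) (c *: u).
  by rewrite /pt scale_row_mx scale_scalar_mx.
have normal e t u : 0 < t -> K (pt (e * t) u) -> K (pt e (t^-1 *: u)).
  move=> t_gt0 Ku; have -> : pt e (t^-1 *: u) = t^-1 *: pt (e * t) u.
    by rewrite ptZ mulrCA mulVf ?mulr1 ?gt_eqF.
  by apply: KZ; rewrite // invr_ge0 ltW.
have nz (c : R) : c != 0 -> col_mx c%:M (0 : 'cV[R]_d) != 0 :> 'cV[R]_(1 + d).
  move=> c_neq0; apply: contra_neq c_neq0 => /matrixP/(_ (lshift d 0) 0).
  by rewrite col_mxEu !mxE eqxx mulr1n.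
have [[up Kup]|no_up] := pselect (exists u, K (pt 1 u)); last first.
  exists (col_mx (-1)%:M 0 : 'cV[R]_(1 + d)).
    by apply: nz; rewrite oppr_eq0 oner_eq0.
  move=> w; have [t [u ->]] := ptP w => Kw.
  rewrite pt_mul mulmx0 [X in _ + X]mxE addr0 mulrN1.
  rewrite oppr_ge0 leNgt; apply/negP => t_gt0.
  by apply: no_up; exists (t^-1 *: u); apply: normal; rewrite ?mul1r.
have [[dn Kdn]|no_dn] := pselect (exists u, K (pt (-1) u)); last first.
  exists (col_mx 1%:M 0 : 'cV[R]_(1 + d)); first by apply: nz; rewrite oner_eq0.
  move=> w; have [t [u ->]] := ptP w => Kw.
  rewrite pt_mul mulmx0 [X in _ + X]mxE addr0 mulr1.
  rewrite leNgt; apply/negP => t_lt0.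
  apply: no_dn; exists ((- t)^-1 *: u); apply: normal.
    by rewrite oppr_gt0.
  by rewrite mulN1r opprK.
have [||l l_neq0 l_ge0] := IHd [set u | K (pt 0 u)].
- split=> /= [|u v Ku Kv|t u t_ge0 Ku].
  + by rewrite /pt raddf0 row_mx0.
  + by rewrite -[0]addr0 -ptD; apply: KD.
  + by rewrite -[0](mulr0 t) -ptZ; apply: KZ.
- move=> sliceT; apply: properK; apply/seteqP; split=> // w _.
  have slice u : K (pt 0 u) by have : [set: 'rV[R]_d] u by []; rewrite -sliceT.
  have [t [u ->]] := ptP w; have [t_ge0|t_lt0] := leP 0 t.
    have -> : pt t u = t *: pt 1 up + pt 0 (u - t *: up).
      by rewrite ptZ ptD mulr1 addr0 addrC subrK.
    by apply: KD => //; apply: KZ.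
  have -> : pt t u = (- t) *: pt (-1) dn + pt 0 (u - (- t) *: dn).
    by rewrite ptZ ptD mulrN1 opprK addr0 addrC subrK.
  by apply: KD => //; apply: KZ => //; rewrite oppr_ge0 ltW.
(* The lower bounds that the points with t = 1 impose on the coefficient of t;
   each point with t = -1 gives an upper bound of S. *)
pose S := [set - (u *m l) 0 0 | u in [set u | K (pt 1 u)]].
have ubS u : K (pt (-1) u) -> ubound S ((u *m l) 0 0).
  move=> Ku _ [v Kv <-]; rewrite lerNl -subr_ge0 opprK addrC.
  have := l_ge0 (v + u); rewrite mulmxDl mxE addrC; apply.
  by rewrite /= -(subrr 1) -ptD; apply: KD.
have supS : has_sup S.
  by split; [exists (- (up *m l) 0 0), up | exists ((dn *m l) 0 0); apply: ubS].
exists (col_mx (sup S)%:M l : 'cV[R]_(1 + d)).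
  apply: contra_neq l_neq0 => /(congr1 (@dsubmx _ 1 d 1)).
  by rewrite col_mxKd linear0.
move=> w; have [t [u ->]] := ptP w => Kw.
rewrite pt_mul; have [t_lt0|t_gt0|t0] := ltgtP t 0.
- have /ubS/(ge_sup supS.1) : K (pt (-1) ((- t)^-1 *: u)).
    by apply: normal; rewrite ?oppr_gt0 // mulN1r opprK.
  rewrite -scalemxAl mxE mulrC ler_pdivlMr ?oppr_gt0 // mulrN mulrC -subr_ge0.
  by rewrite opprK addrC.
- have Su : S (- (t^-1 *: u *m l) 0 0).
    by exists (t^-1 *: u) => //; apply: normal; rewrite ?mul1r.
  have := ub_le_sup supS.2 Su.
  rewrite -scalemxAl mxE -mulrN mulrC ler_pdivrMr // mulrC -subr_ge0.
  by rewrite opprK.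
- by rewrite t0 mul0r add0r; apply: l_ge0; rewrite /= -t0.
Qed.

(** A relation among the generators can be subtracted from a combination until
    a first weight reaches zero, which removes a generator.  The number of
    generators that remain is not bounded here; what matters is their
    independence. *)
Lemma conic_caratheodory (R : realFieldType) (V : lmodType R) (T : Type)
    (a : T -> V) (m : nat) (lambda : 'I_m -> R) (x : 'I_m -> T) :
    (forall j, 0 <= lambda j) ->
  exists (m' : nat) (lambda' : 'I_m' -> R) (x' : 'I_m' -> T),
    [/\ forall j, 0 <= lambda' j,
        \sum_(j < m) lambda j *: a (x j) = \sum_(j < m') lambda' j *: a (x' j) &
        forall c : 'I_m' -> R,
          \sum_(j < m') c j *: a (x' j) = 0 -> forall j, c j = 0].
Proof.
elim: m lambda x => [|m IHm] lambda x lambda_ge0.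
  by exists 0, lambda, x; split=> // c _ [].
have [[c [j0 [c_rel c_gt0]]]|indep] := pselect (exists c j0,
    \sum_(j < m.+1) c j *: a (x j) = 0 /\ 0 < c j0); last first.
  exists m.+1, lambda, x; split=> // c c_rel j; apply/eqP.
  rewrite eq_le !leNgt; apply/andP; split; apply/negP => cj.
    by apply: indep; exists c, j.
  apply: indep; exists (fun j => - c j), j; split; last by rewrite oppr_gt0.
  by under eq_bigr do rewrite scaleNr; rewrite sumrN c_rel oppr0.
(* Among the weights that decrease along c, the one with the smallest ratio to
   c is the first to vanish. *)
case: (@arg_minP _ _ _ j0 (fun j => 0 < c j) (fun j => lambda j / c j) c_gt0).
move=> i ci_gt0 i_min.
pose t := lambda i / c i.
pose lambda1 j := lambda j - t * c j.
have lambda1i : lambda1 i = 0 by rewrite /lambda1 /t divfK ?subrr // gt_eqF.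
have lambda1_ge0 j : 0 <= lambda1 j.
  rewrite subr_ge0; have [cj_le0|cj_gt0] := leP (c j) 0.
    apply: le_trans (lambda_ge0 j); apply: mulr_ge0_le0 => //.
    by rewrite divr_ge0 // ltW.
  by rewrite -ler_pdivlMr //; apply: i_min.
have [m' [lambda' [x' [? sumE indep]]]] :=
  IHm (lambda1 \o lift i) (x \o lift i) (fun j => lambda1_ge0 _).
exists m', lambda', x'; split=> //; rewrite -sumE.
transitivity (\sum_j lambda1 j *: a (x j)); last first.
  by rewrite (bigD1_ord i) //= lambda1i scale0r add0r.
under [RHS]eq_bigr do rewrite scalerBl -scalerA.
by rewrite sumrB -scaler_sumr c_rel scaler0 subr0.
Qed.

(** * Integrals and conic hulls *)

Lemma Rintegral_sum (R : realType) (d : measure_display) (T : measurableType d)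
    (mu : {measure set T -> \bar R}) (D : set T) (I : finType)
    (f : I -> T -> R) : measurable D ->
    (forall i, mu.-integrable D (EFin \o f i)) ->
  \int[mu]_(x in D) (\sum_i f i x) = \sum_i \int[mu]_(x in D) f i x.
Proof.
move=> mD intf; rewrite /Rintegral.
under eq_integral do rewrite -sumEFin.
rewrite (integral_sum mD) // sum_fine // => i _.
exact: integrable_fin_num (intf i).
Qed.

Lemma integrable_sum_EFin (R : realType) (d : measure_display)
    (T : measurableType d) (mu : {measure set T -> \bar R}) (D : set T)
    (I : finType) (f : I -> T -> R) : measurable D ->
    (forall i, mu.-integrable D (EFin \o f i)) ->
  mu.-integrable D (EFin \o (fun x => \sum_i f i x)).
Proof.
move=> mD intf.
rewrite (_ : _ \o _ = fun x => (\sum_i (f i x)%:E)%E).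
  by apply: integrable_sum => // i _; apply: intf.
by apply/funext => x; rewrite /= sumEFin.
Qed.

(** Richter's theorem, by induction on the dimension: an integral [L] outside
    the cone would give a supporting functional that vanishes almost everywhere
    along [a].  On its hyperplane one coordinate is determined by the others, so
    that coordinate can be dropped.  Having an arbitrary domain [D] lets the
    induction discard the exceptional null set. *)
Theorem integral_in_conic_hull (R : realType) (d : measure_display)
    (T : measurableType d) (mu : {measure set T -> \bar R}) (n : nat)
    (D : set T) (a : T -> 'rV[R]_n) : measurable D ->
    (forall i, mu.-integrable D (EFin \o (fun x => a x 0 i))) ->
  conic_hull D a (\row_i \int[mu]_(x in D) a x 0 i).
Proof.
elim: n D a => [|n IHn] D a mD inta.
  set v := \row__ _; rewrite (_ : v = 0); last by apply/rowP; case.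
  by case: (conic_hull_convex_cone D a).
set L := \row_i _; have LE i : L 0 i = \int[mu]_(x in D) a x 0 i by rewrite mxE.
move: L LE => L LE; apply: contrapT => CL.
have [C0 CD CZ] := conic_hull_convex_cone D a.
(* K is the cone generated by the hull and - L. It is proper: if L = v - t L
   with v in the hull, then (1 + t) L is in the hull, and so is L. *)
pose K := [set v | exists2 t : R, 0 <= t & conic_hull D a (v + t *: L)].
have CK v : conic_hull D a v -> K v by exists 0; rewrite ?scale0r ?addr0.
have [||l l_neq0 l_ge0] := @supporting_functional R n.+1 K.
- split=> [|u v [s s_ge0 Cu] [t t_ge0 Cv]|t u t_ge0 [s s_ge0 Cu]].
  + exact: CK.
  + exists (s + t); first exact: addr_ge0.
    by rewrite scalerDl addrACA; apply: CD.
  + exists (t * s); first exact: mulr_ge0.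
    by rewrite -scalerA -scalerDr; apply: CZ.
- move=> KT; have [t t_ge0] : K L by rewrite KT.
  have t1_gt0 : 0 < 1 + t by rewrite ltr_wpDr.
  rewrite -{1}[L]scale1r -scalerDl => /(CZ (1 + t)^-1).
  by rewrite scalerA mulVf ?gt_eqF // scale1r invr_ge0 ltW // => /(_ isT).
pose f x := (a x *m l) 0 0.
have fE : f = (fun x => \sum_i a x 0 i * l i 0).
  by apply/funext => x; rewrite /f mxE.
have intal i : mu.-integrable D (EFin \o (fun x => a x 0 i * l i 0)).
  exact: (integrableZr mD (l i 0) (inta i)).
have f_ge0 x : D x -> 0 <= f x by move=> Dx; apply/l_ge0/CK/mem_conic_hull.
have intf : mu.-integrable D (EFin \o f).
  by rewrite fE; apply: integrable_sum_EFin.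
have mf : measurable_fun D f.
  by apply/measurable_EFinP; apply: measurable_int intf.
have f_int : \int[mu]_(x in D) f x = (L *m l) 0 0.
  rewrite fE Rintegral_sum // mxE; apply: eq_bigr => i _.
  by rewrite LE RintegralZr.
have f_int0 : \int[mu]_(x in D) f x = 0.
  apply/eqP; rewrite eq_le Rintegral_ge0 // andbT f_int -oppr_ge0.
  have := l_ge0 (- L); rewrite mulNmx mxE; apply.
  by exists 1; rewrite // scale1r addNr.
have [N [mN N0 subN]] : ae_eq mu D (EFin \o f) (cst 0%E).
  apply/(ae_eq_integral_abs mu mD); first exact/measurable_EFinP.
  under eq_integral => x /[!inE] Dx do rewrite /= ger0_norm ?f_ge0 //.
  by rewrite -[LHS]fineK ?integrable_fin_num // -/(Rintegral _ _ _) f_int0.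
pose D' := D `\` N.
have mD' : measurable D' by exact: measurableD.
have f_D' x : D' x -> f x = 0.
  move=> [Dx nNx]; apply: contrapT => fx; apply: nNx; apply: subN => /= /(_ Dx).
  by case.
have LE' i : L 0 i = \int[mu]_(x in D') a x 0 i.
  by rewrite LE; congr fine; exact: (negligible_integral mN mD (inta i) N0).
have [i li_neq0] : exists i, l i 0 != 0.
  apply: contrapT => l0; case/eqP: l_neq0; apply/colP => i; rewrite mxE.
  by apply: contrapT => /eqP li; apply: l0; exists i.
have [|m [lambda [x [lambda_ge0 D'x]]]] := IHn D' (fun x => col' i (a x)) mD'.
  move=> j; apply: (@integrableS _ _ _ mu D) => //; first by move=> y [].
  rewrite (_ : _ \o _ = EFin \o (fun x => a x 0 (lift i j))).
    exact: inta.
  by apply/funext => y /=; rewrite mxE.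
set b := \row_j _ => bE; apply: CL; exists m, lambda, x.
split=> // [j|]; first by case: (D'x j).
set s := \sum_(j < m) _.
apply/eqP; rewrite -subr_eq0; apply/eqP; set w := L - s.
(* The error w vanishes in every coordinate but i, and l kills it; as the
   coefficient of l at i is nonzero, w vanishes there too. *)
have w_lift j : w 0 (lift i j) = 0.
  apply/eqP; rewrite 2!mxE subr_eq0 LE' summxE; apply/eqP.
  transitivity (b 0 j).
    by rewrite mxE; apply: eq_Rintegral => y _; rewrite mxE.
  by rewrite bE summxE; apply: eq_bigr => k _; rewrite !mxE.
have wl : (w *m l) 0 0 = 0.
  rewrite mulmxBl mxE -f_int f_int0 add0r mxE mulmx_suml summxE.
  rewrite big1 ?oppr0 // => j _.
  by rewrite -scalemxAl mxE -/(f (x j)) f_D' ?mulr0.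
have w_i : w 0 i = 0.
  move: wl; rewrite mxE (bigD1_ord i) //= big1 ?addr0.
    by move/eqP; rewrite mulf_eq0 (negPf li_neq0) orbF => /eqP.
  by move=> j _; rewrite w_lift mul0r.
apply/rowP => j; rewrite [RHS]mxE.
by case: (unliftP i j) => [k|] ->.
Qed.

(** * Real coordinates of scalars *)

(** Real scalars are given a second coordinate, equal to zero, so that both
    kinds of scalars have their coordinates indexed by [bool]. *)
Definition coordK (R : realType) (s : scalars) (c : bool) :
    scalar_field R s -> R :=
  match s return scalar_field R s -> R with
  | RealScalars => fun a => if c then 0 else a
  | ComplexScalars => fun z => if c then complex.Im z else complex.Re z
  end.

Section real_coordinates.
Variables (R : realType) (s : scalars).
Local Notation K := (scalar_field R s).
Implicit Types (z w : K) (c : bool).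

Lemma coordK0 c : coordK c (0 : K) = 0.
Proof. by case: s c => [] []. Qed.

Lemma coordK_sum c (I : Type) (r : seq I) (P : pred I) (F : I -> K) :
  coordK c (\sum_(i <- r | P i) F i) = \sum_(i <- r | P i) coordK c (F i).
Proof.
apply: big_morph => [z w|]; last exact: coordK0.
case: s z w => [|] z w; first by case: c => //=; rewrite addr0.
by case: z w c => [a b] [a' b'] [].
Qed.

Lemma coordK_real c (t : R) z : coordK c (of_real s t * z) = t * coordK c z.
Proof.
case: s z => [|] z; first by case: c => //=; rewrite mulr0.
by case: z c => [a b] [] /=; simpc => /=; ring.
Qed.

Lemma coordK_inj z w : (forall c, coordK c z = coordK c w) -> z = w.
Proof.
case: s z w => [|] z w zw; first exact: (zw false).
case: z w zw => [a b] [a' b'] zw.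
by congr Complex; [exact: (zw false)|exact: (zw true)].
Qed.

(** [Re z = (z + conj z) / 2] and [Im z = (z - conj z) / 2i]: this is how the
    coordinates of the coefficients of a scalar relation are handled. *)
Lemma of_real_lincomb c :
  exists alpha beta : K, forall z,
    of_real s (coordK c z) = alpha * z + beta * conjK z.
Proof.
case: s; case: c.
- by exists 0, 0 => z /=; rewrite !mul0r addr0.
- by exists 1, 0 => z /=; rewrite mul1r mul0r addr0.
- exists (0 +i* - 2^-1)%C, (0 +i* 2^-1)%C => -[a b] /=.
  by simpc => /=; congr (_ +i* _)%C; field.
- exists (2^-1)%:C%C, (2^-1)%:C%C => -[a b] /=.
  by simpc => /=; congr (_ +i* _)%C; field.
Qed.

Lemma conjK_sum (I : Type) (r : seq I) (P : pred I) (F : I -> K) :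
  conjK (\sum_(i <- r | P i) F i) = \sum_(i <- r | P i) conjK (F i).
Proof. by move: F; case: s => //= F; rewrite rmorph_sum. Qed.

Lemma conjK0 : conjK (0 : K) = 0.
Proof. by case: s => //=; rewrite raddf0. Qed.

Lemma conjKM z w : conjK (z * w) = conjK z * conjK w.
Proof. by move: z w; case: s => //= z w; rewrite rmorphM. Qed.

Lemma conjKK z : conjK (conjK z) = z.
Proof. by move: z; case: s => //= z; rewrite conjcK. Qed.

Lemma of_real0 : of_real s (0 : R) = 0.
Proof. by case: s. Qed.

Lemma absK_sqr z : absK z ^+ 2 = coordK false z ^+ 2 + coordK true z ^+ 2.
Proof.
move: z; case: s => /= [a|[a b]].
  by rewrite expr0n addr0 real_normK ?num_real.
by rewrite sqr_sqrtr // addr_ge0 ?sqr_ge0.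
Qed.

Lemma coordK_mul_conj c z w :
  coordK c (z * conjK w) =
  if c then coordK true z * coordK false w - coordK false z * coordK true w
  else coordK false z * coordK false w + coordK true z * coordK true w.
Proof.
move: z w; case: s => /= [a b|[a b] [a' b']].
  by case: c; rewrite ?mul0r ?mulr0 ?subrr ?addr0.
by simpc; case: c => /=; ring.
Qed.

(** The bound that makes products of square-integrable functions integrable. *)
Lemma normr_coordK_mul_conj c z w :
  `|coordK c (z * conjK w)| <= absK z ^+ 2 + absK w ^+ 2.
Proof.
rewrite coordK_mul_conj !absK_sqr ler_norml.
move: (coordK _ z) (coordK true z) (coordK _ w) (coordK true w) => p q p' q'.
have sqD_ge0 (u v : R) : - (u ^+ 2 + v ^+ 2) <= 2 * (u * v) <= u ^+ 2 + v ^+ 2.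
  by have := sqr_ge0 (u + v); have := sqr_ge0 (u - v); lra.
have := sqD_ge0 p p'; have := sqD_ge0 q q'; have := sqD_ge0 p q'.
have := sqD_ge0 q p'; have := sqr_ge0 p; have := sqr_ge0 q.
by have := sqr_ge0 p'; have := sqr_ge0 q'; case: c; lra.
Qed.

End real_coordinates.

(** * Integrals of scalar functions *)

Section products_of_square_integrable.
Variables (R : realType) (s : scalars).
Variables (d : measure_display) (T : measurableType d).
Variable mu : {measure set T -> \bar R}.
Implicit Types f g : T -> scalar_field R s.

Lemma measurableKP f :
  measurableK f <-> forall c, measurable_fun setT (fun x => coordK c (f x)).
Proof.
move: f; case: s => f /=.
  split=> [mf []|/(_ false)]; [exact: measurable_cst|exact: mf|by []].
by split=> [[mR mI] []|mf] //; split; [exact: (mf false)|exact: (mf true)].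
Qed.

Lemma coordK_integralK c f :
  coordK c (integralK mu f) = Rintegral mu setT (fun x => coordK c (f x)).
Proof.
move: f; case: s => f /=; case: c => //.
by rewrite Rintegral_cst // mul0r.
Qed.

Lemma integrable_absK_sqr f : measurableK f -> square_integrable mu f ->
  mu.-integrable setT (EFin \o (fun x => absK (f x) ^+ 2)).
Proof.
move=> /measurableKP mf f2; apply/integrableP; split.
  apply/measurable_EFinP; under eq_fun do rewrite absK_sqr.
  by apply: measurable_funD; apply: measurable_funX.
by under eq_integral do rewrite /= ger0_norm ?sqr_ge0 //.
Qed.

Lemma measurable_coordK_mul_conj c f g : measurableK f -> measurableK g ->
  measurable_fun setT (fun x => coordK c (f x * conjK (g x))).
Proof.
move=> /measurableKP mf /measurableKP mg.
under eq_fun do rewrite coordK_mul_conj.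
by case: c; [apply: measurable_funB|apply: measurable_funD];
  apply: measurable_funM.
Qed.

Lemma integrable_coordK_mul_conj c f g : measurableK f -> measurableK g ->
    square_integrable mu f -> square_integrable mu g ->
  mu.-integrable setT (EFin \o (fun x => coordK c (f x * conjK (g x)))).
Proof.
move=> mf mg f2 g2.
pose h x : \bar R := (absK (f x) ^+ 2 + absK (g x) ^+ 2)%:E.
apply: (@le_integrable _ _ _ mu setT measurableT _ h).
- exact/measurable_EFinP/measurable_coordK_mul_conj.
- move=> x _; rewrite lee_fin.
  by rewrite [leRHS]ger0_norm ?addr_ge0 ?sqr_ge0 ?normr_coordK_mul_conj.
- exact: (integrableD measurableT (integrable_absK_sqr mf f2)
                                  (integrable_absK_sqr mg g2)).
Qed.

End products_of_square_integrable.

(** The weighted sum of Dirac masses; the sequences [w] and [y] extend the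
    weights and points by default values, since finite sums of measures are
    taken over initial segments of sequences. *)
Lemma discrete_measure (R : realType) (d : measure_display)
    (T : measurableType d) (m : nat) (lambda : 'I_m -> R) (x : 'I_m -> T) :
    (forall j, 0 <= lambda j) ->
  exists mu : {measure set T -> \bar R}, forall f : T -> R,
    measurable_fun setT f ->
    mu.-integrable setT (EFin \o f) /\
    \int[mu]_y f y = \sum_(j < m) lambda j * f (x j).
Proof.
move=> lambda_ge0.
pose w (j : nat) : R := oapp lambda 0 (insub j).
have w_ge0 j : 0 <= w j by rewrite /w; case: insub => //= i.
pose y (j : nat) : T := oapp x point (insub j).
pose mu : {measure set T -> \bar R} :=
  msum (fun j => mscale (NngNum (w_ge0 j)) (dirac (y j))) m.
have mu_int (f : T -> \bar R) : measurable_fun setT f ->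
    (forall z, (0 <= f z)%E) ->
    (\int[mu]_z f z = \sum_(j < m) (lambda j)%:E * f (x j))%E.
  move=> mf f_ge0; rewrite ge0_integral_measure_sum //.
  apply: eq_bigr => j _; rewrite ge0_integral_mscale //= integral_dirac //.
  by rewrite diracT mul1e /w /y !valK.
exists mu => f mf.
have mEf : measurable_fun setT (EFin \o f) by exact/measurable_EFinP.
have intf : mu.-integrable setT (EFin \o f).
  apply/integrableP; split=> //; rewrite mu_int //.
    by rewrite sumEFin ltry.
  exact: measurableT_comp.
split=> //; rewrite /Rintegral integralE !mu_int //;
  [|exact: measurable_funeneg|exact: measurable_funepos].
rewrite (eq_bigr (fun j => (lambda j * Num.max (f (x j)) 0)%:E)); last first.
  by move=> j _; rewrite funeposE EFinM EFin_max.
rewrite [X in (_ - X)%E](eq_bigr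
  (fun j => (lambda j * Num.max (- f (x j)) 0)%:E)); last first.
  by move=> j _; rewrite funenegE EFinM EFin_max EFinN.
rewrite !sumEFin -EFinB /= -sumrB; apply: eq_bigr => j _.
rewrite -mulrBr; congr (_ * _).
have [f_ge0|/ltW f_le0] := leP 0 (f (x j)).
  by rewrite max_r ?oppr_le0 // subr0.
by rewrite max_l ?oppr_ge0 // sub0r opprK.
Qed.

(** * The cone of the matrices of products *)

Definition realify (R : realType) (s : scalars) (n : nat)
    (M : 'M[scalar_field R s]_n) : 'rV[R]_#|{: bool * 'I_n * 'I_n}| :=
  \row_i let: (c, k, l) := enum_val i in coordK c (M k l).

Lemma realify_comb (R : realType) (s : scalars) (n m : nat) (lambda : 'I_m -> R)
    (M : 'I_m -> 'M[scalar_field R s]_n) :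
  realify (\sum_(j < m) of_real s (lambda j) *: M j) =
  \sum_(j < m) lambda j *: realify (M j).
Proof.
apply/rowP => i; rewrite summxE mxE.
under [RHS]eq_bigr do rewrite !mxE.
case: (enum_val i) => -[c k] l; rewrite summxE coordK_sum.
by apply: eq_bigr => j _; rewrite mxE coordK_real.
Qed.

Lemma realify0 (R : realType) (s : scalars) (n : nat) :
  realify (0 : 'M[scalar_field R s]_n) = 0.
Proof.
apply/rowP => i; rewrite !mxE; case: (enum_val i) => -[c k] l.
by rewrite mxE coordK0.
Qed.

Lemma realify_inj (R : realType) (s : scalars) (n : nat) :
  injective (@realify R s n).
Proof.
move=> M M' /rowP MM'; apply/matrixP => k l; apply: coordK_inj => c.
by have := MM' (enum_rank (c, k, l)); rewrite !mxE enum_rankK.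
Qed.

Lemma coneP (R : realType) (s : scalars) (V : lmodType (scalar_field R s))
    (T : Type) (A : T -> V) (v : V) :
  cone (range A) v <->
  exists (m : nat) (lambda : 'I_m -> R) (x : 'I_m -> T),
    (forall j, 0 <= lambda j) /\
    v = \sum_(j < m) of_real s (lambda j) *: A (x j).
Proof.
split=> [[m [lambda [u [lambda_ge0 Au ->]]]]|[m [lambda [x [lambda_ge0 ->]]]]].
  have [j|x xE] := @choice _ _ (fun j y => A y = u j).
    by have [y _ <-] := Au j; exists y.
  exists m, lambda, x; split=> //.
  by apply: eq_bigr => j _; rewrite xE.
by exists m, lambda, (A \o x); split=> // j; exists (x j).
Qed.

Section products.
Variables (R : realType) (s : scalars) (Omega : Type) (n : nat).
Variable phi : 'I_n -> Omega -> scalar_field R s.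
Local Notation K := (scalar_field R s).

Definition product_matrix (x : Omega) : 'M[K]_n :=
  \matrix_(k < n, l < n) (phi k x * conjK (phi l x)).

Lemma cone_productP :
  cone (range product_matrix) 1%:M <->
  exists (m : nat) (lambda : 'I_m -> R) (x : 'I_m -> Omega),
    (forall j, 0 <= lambda j) /\
    (forall k l, \sum_(j < m) of_real s (lambda j) *
                   (phi k (x j) * conjK (phi l (x j))) = (k == l)%:R).
Proof.
rewrite coneP; split=> -[m [lambda [x [lambda_ge0 E]]]];
    exists m, lambda, x; split=> //.
  move=> k l; have /matrixP/(_ k l) := E.
  rewrite mxE -[LHS]/((k == l)%:R) => ->.
  by rewrite summxE; apply: eq_bigr => j _; rewrite !mxE.
apply/matrixP => k l; rewrite mxE -[LHS]/((k == l)%:R) -E summxE.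
by apply: eq_bigr => j _; rewrite !mxE.
Qed.

(** The matrices are Hermitian: conjugating and transposing a relation with
    coefficients [z] gives one with coefficients [conj z], hence one with the
    real coefficients [coordK c z]. *)
Lemma real_independent_scalar_independent (m : nat) (x : 'I_m -> Omega) :
    (forall c : 'I_m -> R,
       \sum_(j < m) c j *: realify (product_matrix (x j)) = 0 ->
       forall j, c j = 0) ->
  forall z : 'I_m -> K,
    (forall k l, \sum_(j < m) z j * (phi k (x j) * conjK (phi l (x j))) = 0) ->
  forall j, z j = 0.
Proof.
move=> indep z z_rel j; apply: coordK_inj => c.
have [alpha [beta lincomb]] := of_real_lincomb R s c.
rewrite coordK0.
suff rel : \sum_(i < m) coordK c (z i) *: realify (product_matrix (x i)) = 0.
  exact: (indep (fun i => coordK c (z i)) rel).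
rewrite -realify_comb -[RHS](realify0 R s n); congr realify.
apply/matrixP => k l; rewrite summxE [RHS]mxE.
have conj_rel :
    \sum_(i < m) conjK (z i) * (phi k (x i) * conjK (phi l (x i))) = 0.
  have := congr1 (@conjK R s) (z_rel l k); rewrite conjK_sum => rel.
  transitivity (conjK (0 : K)); last exact: conjK0.
  rewrite -rel; apply: eq_bigr => i _.
  by rewrite !conjKM conjKK [conjK _ * phi _ _]mulrC.
under eq_bigr do rewrite !mxE lincomb mulrDl -!mulrA.
by rewrite big_split /= -!mulr_sumr z_rel conj_rel !mulr0 addr0.
Qed.

(** The matrix of the values at the [m] points of a basis of the span has
    independent rows, hence at most as many rows as columns. *)
Lemma leq_dim_of_independent_points (N m : nat) (x : 'I_m -> Omega) :
    has_dim (lin (pairwise_products phi)) N ->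
    (forall z : 'I_m -> K,
      (forall k l,
         \sum_(j < m) z j * (phi k (x j) * conjK (phi l (x j))) = 0) ->
      forall j, z j = 0) ->
  (m <= N)%N.
Proof.
move=> [b [_ spanb]] indep.
pose B : 'M[K]_(m, N) := \matrix_(j, i) b i (x j).
suff /eqP <- : row_free B by apply: rank_leq_col.
apply: inj_row_free => v vB; apply/rowP => j; rewrite mxE.
apply: (indep (fun j => v 0 j)) => k l.
have vb i : \sum_(j < m) v 0 j * b i (x j) = 0.
  transitivity ((v *m B) 0 i); last by rewrite vB mxE.
  by rewrite mxE; apply: eq_bigr => j' _; rewrite mxE.
pose f : Omega -> K^o := fun y => phi k y * conjK (phi l y).
have : lin (range b) f.
  rewrite spanb; exists 1%N, (fun=> 1), (fun=> f).
  split=> [_|]; first by exists k, l.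
  by rewrite big_ord1 scale1r.
move=> [p [c [u [bu fE]]]].
transitivity (\sum_(j < m) v 0 j * f (x j)) => //.
have fxE y : f y = \sum_(i < p) c i * u i y by rewrite fE fct_sumE.
under eq_bigr do rewrite fxE mulr_sumr.
rewrite exchange_big big1 //= => i _.
under eq_bigr do rewrite mulrCA.
by rewrite -mulr_sumr; have [i' _ <-] := bu i; rewrite vb mulr0.
Qed.

Lemma orthonormal_cone : orthonormal_for_some_measure phi ->
  cone (range product_matrix) 1%:M.
Proof.
move=> [x0 [Sigma [mu [_ [mphi phi2 ortho]]]]].
pose T : measurableType _ := g_sigma_algebraType Sigma.
have inta i : mu.-integrable setT
    (EFin \o (fun x : T => realify (product_matrix x) 0 i)).
  case E : (enum_val i) => [[c k] l].
  rewrite (_ : (fun x => _) =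
               (fun x : T => coordK c (phi k x * conjK (phi l x)))).
    exact: integrable_coordK_mul_conj.
  by apply/funext => x; rewrite mxE E mxE.
have [m [lambda [x [lambda_ge0 _]]]] := integral_in_conic_hull measurableT inta.
set v := \row__ _ => vE; apply/coneP; exists m, lambda, x; split=> //.
apply: realify_inj; rewrite realify_comb -vE; apply/rowP => i.
rewrite !mxE; case E : (enum_val i) => [[c k] l].
rewrite mxE -[_ *+ _]/((k == l)%:R) -(ortho k l) coordK_integralK.
by apply: eq_Rintegral => y _; rewrite mxE E mxE.
Qed.

(** Declaring every subset measurable makes all functions measurable.  The
    base point of the measurable type is one of the points of the combination,
    which is not empty because the identity matrix is nonzero. *)
Lemma cone_orthonormal : (0 < n)%N ->
  cone (range product_matrix) 1%:M -> orthonormal_for_some_measure phi.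
Proof.
move=> n_gt0 /cone_productP[m [lambda [x [lambda_ge0 ortho]]]].
have m_gt0 : (0 < m)%N.
  rewrite lt0n; apply/eqP => m0; subst m.
  have := ortho (Ordinal n_gt0) (Ordinal n_gt0).
  by rewrite big_ord0 eqxx => /esym/eqP; rewrite oner_eq0.
pose x0 := x (Ordinal m_gt0); pose Sigma : set (set (pointed_at x0)) := setT.
pose T : measurableType _ := g_sigma_algebraType Sigma.
have mset (A : set T) : measurable A by apply: sub_sigma_algebra.
have mfun (f : T -> R) : measurable_fun setT f by move=> _ Y _; apply: mset.
have [mu muP] := discrete_measure (x : 'I_m -> T) lambda_ge0.
have mK (f : T -> scalar_field R s) : measurableK f.
  by apply/measurableKP => c; apply: mfun.
exists x0, Sigma, mu; split.
  by split=> // A _; apply: mset.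
split=> [j|j|k l]; first exact: mK.
  have [/integrableP[_]] := muP (fun y => absK (phi j y) ^+ 2) (mfun _).
  by under eq_integral do rewrite /= ger0_norm ?sqr_ge0 //.
apply: coordK_inj => c; rewrite coordK_integralK -ortho coordK_sum.
rewrite (muP _ (mfun _)).2; apply: eq_bigr => j _.
by rewrite coordK_real.
Qed.

(** The reduced combination uses at most [N] points; the remaining indices
    repeat one of these points with weight zero, which requires the combination
    not to be empty. *)
Lemma cone_at_most_dim_points (N : nat) : (0 < n)%N ->
    has_dim (lin (pairwise_products phi)) N ->
    cone (range product_matrix) 1%:M ->
  exists (x : 'I_N -> Omega) (w : 'I_N -> R),
    (forall j, 0 <= w j) /\
    (forall k l, \sum_(j < N) of_real s (w j) *
                   (phi k (x j) * conjK (phi l (x j))) = (k == l)%:R).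
Proof.
move=> n_gt0 dimN /coneP[m0 [lambda0 [x0 [lambda0_ge0 id_comb]]]].
have [m [lambda [x [lambda_ge0 sumE indep]]]] :=
  conic_caratheodory (fun y => realify (product_matrix y)) x0 lambda0_ge0.
have leqmN : (m <= N)%N.
  exact: (leq_dim_of_independent_points dimN
            (real_independent_scalar_independent indep)).
have ortho k l : \sum_(j < m) of_real s (lambda j) *
                   (phi k (x j) * conjK (phi l (x j))) = (k == l)%:R.
  have : 1%:M = \sum_(j < m) of_real s (lambda j) *: product_matrix (x j).
    by apply: realify_inj; rewrite id_comb !realify_comb.
  move/matrixP/(_ k l); rewrite mxE -[_ *+ _]/((k == l)%:R) => ->.
  by rewrite summxE; apply: eq_bigr => j _; rewrite !mxE.
have m_gt0 : (0 < m)%N.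
  rewrite lt0n; apply/eqP => m_eq0; subst m.
  have := ortho (Ordinal n_gt0) (Ordinal n_gt0).
  by rewrite big_ord0 eqxx => /esym/eqP; rewrite oner_eq0.
pose j0 := Ordinal m_gt0.
exists (fun j => x (insubd j0 (val j))),
  (fun j => oapp lambda 0 (insub (val j))); split=> [j|k l].
  by case: insub => //= i.
rewrite -ortho.
pose F j := of_real s (oapp lambda 0 (insub j)) *
  (phi k (x (insubd j0 j)) * conjK (phi l (x (insubd j0 j)))).
transitivity (\sum_(j < N) F j) => //.
rewrite -(big_mkord xpredT F) (big_cat_nat (leq0n m) leqmN) //=.
rewrite [X in _ + X]big1_seq ?addr0.
  by rewrite big_mkord; apply: eq_bigr => j _; rewrite /F valK valKd.
move=> j /andP[_]; rewrite mem_index_iota => /andP[mj _].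
by rewrite /F insubF /= ?of_real0 ?mul0r // ltnNge mj.
Qed.

End products.

Theorem proposition6p1 (R : realType) (s : scalars) (Omega : Type)
    (n : nat) (n_gt0 : (0 < n)%N)
    (phi : 'I_n -> Omega -> scalar_field R s)
    (N : nat)
    (dimN : has_dim (lin (pairwise_products phi)) N) :
  [<-> (* (i) *)
       cone (range (fun x : Omega =>
               \matrix_(k < n, l < n) (phi k x * conjK (phi l x)))) 1%:M;
       (* (ii) *)
       orthonormal_for_some_measure phi;
       (* (iii) *)
       exists (x : 'I_N -> Omega) (w : 'I_N -> R),
         (forall j, 0 <= w j) /\
         (forall k l : 'I_n,
            \sum_(j < N) of_real s (w j) * phi k (x j) * conjK (phi l (x j))
            = (k == l)%:R)].
Proof.
tfae.
- exact: cone_orthonormal.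
- move=> /orthonormal_cone/(cone_at_most_dim_points n_gt0 dimN).
  move=> [x [w [w_ge0 ortho]]].
  exists x, w; split=> // k l; rewrite -ortho.
  by apply: eq_bigr => j _; rewrite mulrA.
- move=> [x [w [w_ge0 ortho]]]; apply/cone_productP.
  exists N, w, x; split=> // k l; rewrite -ortho.
  by apply: eq_bigr => j _; rewrite mulrA.
Qed.
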